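(* Let $\mathbb{F}_q$ be a finite field with $q$ elements. Let $M$ be a square multislant matrix (over $\mathbb{F}_q$) that is not the $0 \times 0$-matrix. Let $(i,j,\ell)$ be the signature of $M$, and let $k = i+j+\ell$ be the number of blocks of $M$. Then $$\operatorname{SiPr} M = 1-\gamma_{k}\left(1-\frac{0^{\ell}}{q^{i}}\right),$$ where $0^\ell = 0$ if $\ell > 0$ and $0^\ell = 1$ if $\ell = 0$.
   Context: All matrices have entries in $\mathbb{F}_q$ or in a polynomial ring over $\mathbb{F}_q$. Slant matrix: a $u \times v$-matrix $A = (a_{r,c})$ with $u \geq v \geq 1$ is a slant matrix if, with $m := u - v \geq 0$: (1) $A$ is Toeplitz, i.e., $a_{r,c}$ depends only on $r-c$; (2) all entries $a_{r,c}$ with $r - c > m$ (''basement entries'') are $0$; (3) there are $u_0, u_1, \ldots, u_m$ such that $a_{r,c} = u_{m-d}$ whenever $r - c = d$ with $0 \leq d \leq m$, where $u_1, \ldots, u_m$ are distinct indeterminates, and $u_0$ is either an indeterminate distinct from $u_1, \ldots, u_m$ or an element of $\mathbb{F}_q$; (4) each entry $a_{r,c}$ with $r < c$ (''attic entry'') is an indeterminate or an element of $\mathbb{F}_q$; (5) no indeterminate among the attic entries equals any of the indeterminates among $u_0, \ldots, u_m$. (Indeterminates on different attic diagonals may coincide.) Types: $A$ has type X if $u_0$ is an indeterminate, type 0 if $u_0 = 0$, and type 1 if $u_0 \in \mathbb{F}_q \setminus \{0\}$. Two slant matrices are disjoint if no indeterminate appears in both. Multislant matrix: a block matrix $M = (A_1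 \mid A_2 \mid \cdots \mid A_k)$ (blocks arranged horizontally from left to right), where $A_1, \ldots, A_k$ are pairwise disjoint slant matrices with the same number of rows; these are called the blocks of $M$. The signature of $M$ is $(i,j,\ell)$, where $i$, $j$, $\ell$ are the numbers of blocks of type X, type 0, type 1, respectively. Singular probability: for a square multislant matrix $M$, $\operatorname{SiPr} M$ is the probability that $\det M$ becomes $0$ when uniformly and independently random elements of $\mathbb{F}_q$ are substituted for the (distinct) indeterminates appearing in $M$. For each positive integer $k$, $\gamma_k := \prod_{s=1}^{k-1}\left(1 - \frac{1}{q^s}\right)$ (so $\gamma_1 = 1$); also $\gamma_0 := 1$. *)

(* Defs.v *)
From mathcomp Require Import all_boot all_order all_algebra.
From mathcomp.multinomials Require Import mpoly.

Set Implicit Arguments.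
Unset Strict Implicit.
Unset Printing Implicit Defensive.

Import GRing.Theory.
Local Open Scope ring_scope.

(* The indeterminates are drawn from an arbitrary finite pool 'X_0 ... 'X_(n-1),
   not all of which need to appear in a given matrix. *)
Section Slant.
Variables (F : finFieldType) (n : nat).
Implicit Types p : {mpoly F[n]}.

Definition is_indet p : bool := [exists x : 'I_n, p == 'X_x].

Definition is_const p : bool := [exists a : F, p == a%:MP].

Definition is_nzconst p : bool := [exists a : F, (a != 0) && (p == a%:MP)].

Definition appears_in (x : 'I_n) p : bool :=
  has (fun mon : 'X_{1..n} => mon x != 0%N) (msupp p).

Definition indets u v (A : 'M[{mpoly F[n]}]_(u, v)) : {set 'I_n} :=
  [set x | [exists r, exists c, appears_in x (A r c)]].

(* Differences r - c of indices are compared without truncated subtraction: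
   r - c = r' - c' reads r + c' = r' + c, and, with m = u - v, the equation
   r - c = m - e reads r + e = c + m.  The basement, the attic and the u_e are
   the diagonals r - c > m, r - c < 0 and r - c = m - e respectively. *)
Definition slant u v (A : 'M[{mpoly F[n]}]_(u, v)) : Prop :=
  let m := (u - v)%N in
  (1 <= v <= u)%N /\
  (forall (r r' : 'I_u) (c c' : 'I_v),
      (r + c' = r' + c)%N -> A r c = A r' c') /\
  (forall (r : 'I_u) (c : 'I_v), (c + m < r)%N -> A r c = 0) /\
  (exists w : 'I_m.+1 -> {mpoly F[n]},
     (forall (r : 'I_u) (c : 'I_v) (e : 'I_m.+1),
         (r + e = c + m)%N -> A r c = w e) /\
     (forall e : 'I_m.+1, (0 < e)%N -> is_indet (w e)) /\
     (forall e e' : 'I_m.+1, (0 < e)%N -> (0 < e')%N -> w e = w e' -> e = e') /\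
     (is_indet (w ord0) /\ (forall e : 'I_m.+1, (0 < e)%N -> w ord0 <> w e)
      \/ is_const (w ord0)) /\
     (forall (r : 'I_u) (c : 'I_v), (r < c)%N ->
         is_indet (A r c) \/ is_const (A r c)) /\
     (forall (r : 'I_u) (c : 'I_v) (e : 'I_m.+1), (r < c)%N ->
         is_indet (A r c) -> is_indet (w e) -> A r c <> w e)).

(* [u0_satisfies P A] says that u_0, which fills the diagonal r - c = u - v
   (never empty when 1 <= v <= u), satisfies P. *)
Definition u0_satisfies (P : pred {mpoly F[n]}) u v
    (A : 'M[{mpoly F[n]}]_(u, v)) : bool :=
  [exists r : 'I_u, exists c : 'I_v, (r == c + (u - v) :> nat)%N && P (A r c)].

Definition typeX u v (A : 'M[{mpoly F[n]}]_(u, v)) := u0_satisfies is_indet A.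
Definition type0 u v (A : 'M[{mpoly F[n]}]_(u, v)) := u0_satisfies (pred1 0) A.
Definition type1 u v (A : 'M[{mpoly F[n]}]_(u, v)) := u0_satisfies is_nzconst A.

Definition multislant u k (v : 'I_k -> nat)
    (A : forall b, 'M[{mpoly F[n]}]_(u, v b)) : Prop :=
  (forall b, slant (A b)) /\
  (forall b b', b != b' -> [disjoint indets (A b) & indets (A b')]).

Definition signature u k (v : 'I_k -> nat)
    (A : forall b, 'M[{mpoly F[n]}]_(u, v b)) : nat * nat * nat :=
  (#|[set b | typeX (A b)]|, #|[set b | type0 (A b)]|,
   #|[set b | type1 (A b)]|).

(* Values outside X are irrelevant: they are only used for indeterminates that
   do not appear. *)
Definition subst_of (X : {set 'I_n}) (t : {ffun {x | x \in X} -> F}) :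
    'I_n -> F :=
  fun x => oapp t 0 (insub x).

Definition SiPr N (M : 'M[{mpoly F[n]}]_N) : rat :=
  #|[set t : {ffun {x | x \in indets M} -> F} |
       (\det M).@[subst_of t] == 0]|%:R
  / #|{: {ffun {x | x \in indets M} -> F}}|%:R.

End Slant.

Definition gamma (q k : nat) : rat :=
  \prod_(1 <= s < k) (1 - 1 / q%:R ^+ s).

(* Main.v *)
(* A square matrix is singular iff some row vector x <> 0 satisfies x M = 0.
   Reading x and the diagonals of block b as power series x(z) and a_b(z), the
   latter starting with u_0, u_1, ..., this means that the coefficients of
   x(z) a_b(z) in the degrees N - v_b <= s < N all vanish, where v_b is the width
   of the block.

   Fix the attic entries and the u_0 of every block.  If all u_0 vanish, then so
   does the last row.  Otherwise let p be a widest block with u_0 <> 0.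
   Subtracting multiples of a_p from the other a_b makes the other u_0 vanish;
   as p is widest, this shifts the attics by constants and changes the other
   entries of the remaining blocks by a measure-preserving map.  Expanding along
   the last row then gives a matrix of size N - 1 in which block p is one column
   narrower and the leads of the other blocks are uniform.  If block p survives,
   the number of blocks is unchanged; otherwise the remaining k - 1 blocks are of
   type X, and averaging over their leads gives the factor 1 - 1/q^(k-1). *)
Require Import Defs.
From mathcomp Require Import all_boot all_order all_algebra.
From mathcomp.multinomials Require Import mpoly.
From mathcomp Require Import zify ring.

Set Implicit Arguments.
Unset Strict Implicit.

Import GRing.Theory Num.Theory.
Local Open Scope ring_scope.

(** * Averages over finite sample spaces *)

Section Mean.
Variable Omega : finType.

Definition mean (f : Omega -> rat) : rat := (\sum_t f t) / #|Omega|%:R.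

Lemma eq_mean f g : f =1 g -> mean f = mean g.
Proof. by move=> fg; congr (_ / _); apply: eq_bigr. Qed.

Lemma mean_const c : (0 < #|Omega|)%N -> mean (fun=> c) = c.
Proof.
move=> O_gt0; rewrite /mean sumr_const -[_ *+ _]mulr_natr mulfK //.
by rewrite pnatr_eq0 -lt0n.
Qed.

Lemma mean_reindex (h : Omega -> Omega) f :
  injective h -> mean (f \o h) = mean f.
Proof. by move=> h_inj; rewrite /mean [in RHS](reindex_inj h_inj). Qed.

Lemma meanMl c f : mean (fun t => c * f t) = c * mean f.
Proof. by rewrite /mean -mulr_sumr mulrA. Qed.

Lemma meanB f g : mean (fun t => f t - g t) = mean f - mean g.
Proof. by rewrite /mean sumrB mulrBl. Qed.

End Mean.

Lemma exchange_mean (O1 O2 : finType) (f : O1 -> O2 -> rat) :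
  mean (fun t => mean (f t)) = mean (fun u => mean (f^~ u)).
Proof.
rewrite /mean -!mulr_suml exchange_big /= -!mulrA; congr (_ * _).
exact: mulrC.
Qed.

(** * Resampling some coordinates of a random function *)

Section Override.
Variables (F I J : finType) (iota : J -> option I).
Hypothesis iota_inj : forall j j' i,
  iota j = Some i -> iota j' = Some i -> j = j'.

(** [iota] is partial because an index in [J] may have no counterpart in [I]; that coordinate of [w]
    is then never read. *)
Definition override (t : {ffun I -> F}) (w : {ffun J -> F}) : {ffun I -> F} :=
  [ffun i => oapp w (t i) [pick j | iota j == Some i]].

Lemma override_some t w i j : iota j = Some i -> override t w i = w j.
Proof.
move=> ji; rewrite ffunE; case: pickP => [j' /eqP j'i | /(_ j)] /=.
  by rewrite (iota_inj ji j'i).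
by rewrite ji eqxx.
Qed.

Lemma override_none t w i : (forall j, iota j <> Some i) -> override t w i = t i.
Proof. by move=> ni; rewrite ffunE; case: pickP => // j /eqP /ni. Qed.

(* Exchanging the coordinates matched by [iota] is an involution of the pairs
   [(t, w)]. *)
Lemma mean_override (f : {ffun I -> F} -> rat) : (0 < #|F|)%N ->
  mean f = mean (fun t => mean (fun w => f (override t w))).
Proof.
move=> F_gt0.
have card_gt0 (K : finType) : (0 < #|{: {ffun K -> F}}|)%N.
  by rewrite card_ffun expn_gt0 F_gt0.
pose swap (tw : {ffun I -> F} * {ffun J -> F}) :=
  (override tw.1 tw.2, [ffun j => oapp tw.1 (tw.2 j) (iota j)]).
have swapK : involutive swap.
  move=> [t w]; congr (_, _); [apply/ffunP => i /= | apply/ffunP => j /=].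
    rewrite [LHS]ffunE; case: pickP => [j /eqP ji | ni] /=.
      by rewrite ffunE ji.
    by apply: override_none => j /eqP; rewrite ni.
  rewrite [LHS]ffunE; case ji: (iota j) => [i|] /=.
    exact: override_some.
  by rewrite ffunE ji.
(* Read [f t] as a function of the pair [(t, w)] that ignores [w]; reindexing the pairs by [swap]
   then turns [t] into [override t w]. *)
transitivity (mean (fun t : {ffun I -> F} => mean (fun w : {ffun J -> F} => f t))).
  by apply: eq_mean => t; rewrite mean_const.
rewrite /mean -!mulr_suml; congr (_ / _ / _).
rewrite !pair_big /= (reindex_inj (inv_inj swapK)).
by apply: eq_bigr.
Qed.

End Override.

(** * Singularity as vanishing of convolution coefficients *)

Section Singular.
Variables (F : finFieldType) (B : finType).
Implicit Types (v : B -> nat) (a : B -> nat -> F) (x : nat -> F).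

Definition conv (x a : nat -> F) s := \sum_(r < s.+1) x r * a (s - r)%N.

Definition zext N (x : {ffun 'I_N -> F}) r := oapp x 0 (insub r).

(** A block of width 0 imposes no condition, so blocks can be used up while the index type [B] stays
    fixed. For [N = 0] there is no nonzero [x], which agrees with the empty determinant being 1. *)
Definition singular N v a : bool :=
  [exists x : {ffun 'I_N -> F}, [exists r, x r != 0] &&
    [forall b, forall s : 'I_N,
       (N - v b <= s)%N ==> (conv (zext x) (a b) s == 0)]].

Lemma eq_conv x x' (a a' : nat -> F) s :
  (forall r, (r <= s)%N -> x r = x' r) -> (forall e, (e <= s)%N -> a e = a' e) ->
  conv x a s = conv x' a' s.
Proof.
move=> xx' aa'; apply: eq_bigr => r _.
by rewrite xx' ?aa' ?leq_subr // -ltnS.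
Qed.

Lemma singularP N v a :
  reflect (exists2 x : nat -> F, exists2 r, (r < N)%N & x r != 0 &
     forall b s, (N - v b <= s)%N -> (s < N)%N -> conv x (a b) s = 0)
    (singular N v a).
Proof.
apply: (iffP existsP) => [[x /andP[/existsP[r xr] /forallP x0]] | [x [r ltrN xr] x0]].
  exists (zext x); first by exists r; rewrite // /zext valK.
  move=> b s les ltsN; have /forallP/(_ (Ordinal ltsN)) := x0 b.
  by move/implyP/(_ les)/eqP.
exists [ffun r : 'I_N => x r]; apply/andP; split.
  by apply/existsP; exists (Ordinal ltrN); rewrite ffunE.
apply/forallP => b; apply/forallP => s; apply/implyP => les; apply/eqP.
rewrite -[RHS](x0 b s les (ltn_ord s)); apply: eq_conv => // r' ler'.
have ltr' : (r' < N)%N by apply: leq_ltn_trans ler' (ltn_ord s).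
by rewrite /zext insubT /= ffunE.
Qed.

Lemma eq_singular N v a a' :
  (forall b e, (e < N)%N -> a b e = a' b e) -> singular N v a = singular N v a'.
Proof.
move=> aa'; apply/singularP/singularP => -[x nzx x0]; exists x => // b s les lts;
  rewrite -[RHS](x0 b s les lts); apply: eq_conv => // e lee;
  by rewrite aa' // (leq_ltn_trans lee).
Qed.

Lemma singular_lead0 N v a : (0 < N)%N ->
  (forall b, (0 < v b)%N -> a b 0%N = 0) -> singular N v a.
Proof.
case: N => // N _ a0; apply/singularP.
(* The last unit vector: it meets only the leads, in degree [N]. *)
exists (fun r => (r == N)%:R); first by exists N; rewrite ?eqxx ?oner_eq0.
move=> b s les lts; apply: big1 => r _.
have [/eqP rN | _] := eqVneq (r : nat) N; last by rewrite mul0r.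
have sr : (s - r = 0)%N by move: (ltn_ord r); lia.
by rewrite sr a0 ?mulr0 //; lia.
Qed.

(* Column operations: [c b] is nonzero only when block [p] is at least as wide
   as block [b]. *)
Lemma singular_reduce N v a p (c : B -> F) :
  c p = 0 -> (forall b, c b != 0 -> (v b <= v p)%N) ->
  singular N v (fun b e => a b e - c b * a p e) = singular N v a.
Proof.
move=> cp c_wide.
have convB x b s :
    conv x (fun e => a b e - c b * a p e) s = conv x (a b) s - c b * conv x (a p) s.
  by rewrite /conv mulr_sumr -sumrB; apply: eq_bigr => r _; rewrite mulrBr mulrCA.
have Sp x b s : (forall s, (N - v p <= s)%N -> (s < N)%N -> conv x (a p) s = 0) ->
    (N - v b <= s)%N -> (s < N)%N -> c b * conv x (a p) s = 0.
  move=> xp les lts; have [->|/c_wide wide] := eqVneq (c b) 0; first exact: mul0r.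
  by rewrite xp ?mulr0 //; lia.
apply/singularP/singularP => -[x nzx x0]; exists x => // b s les lts.
  have := x0 b s les lts; rewrite convB Sp ?subr0 // => s' les' lts'.
  by have := x0 p s' les' lts'; rewrite convB cp mul0r subr0.
by rewrite convB (x0 b) // Sp ?subr0 // => s'; apply: x0.
Qed.

Lemma convS x (a : nat -> F) s :
  conv x a s.+1 = conv x (fun e => a e.+1) s + x s.+1 * a 0%N.
Proof.
rewrite /conv big_ord_recr /= subnn; congr (_ + _).
by apply: eq_bigr => r _; rewrite subSn // -ltnS.
Qed.

(* Laplace expansion along the last row, whose only nonzero entry is the lead of
   block [p]. *)
Lemma singular_expand N v a p : (0 < v p)%N -> a p 0%N != 0 ->
  (forall b, b != p -> (v b <= N)%N) ->
  (forall b, b != p -> (0 < v b)%N -> a b 0%N = 0) ->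
  singular N.+1 v a =
  singular N (fun b => v b - (b == p))%N
           (fun b e => if b == p then a b e else a b e.+1).
Proof.
move=> vp ap vb ab; apply/singularP/singularP => -[x [r ltr xr] x0].
  exists x.
    (* Truncating [x] below [N] leaves it nonzero: if only [x N] were nonzero, the equation of block
       [p] in degree [N] would read [x N * a p 0 = 0]. *)
    have [ltrN | leNr] := ltnP r N; first by exists r.
    have rN : r = N by lia.
    have [/existsP[r' xr']|/existsPn xN] := boolP [exists r' : 'I_N, x r' != 0].
      by exists r'.
    have := x0 p N; rewrite /conv big_ord_recr /= big1 => [|r' _].
      rewrite add0r subnn -rN => /(_ _ _)/eqP; rewrite mulf_eq0 (negPf xr) (negPf ap).
      by move=> /(_ ltac:(lia) ltac:(lia)).
    by have /negbNE/eqP -> := xN r'; rewrite mul0r.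
  move=> b s; have [-> | bp] := eqVneq b p => les lts.
    by apply: x0; lia.
  (* As the lead of [b] vanishes, its equation in degree [s.+1] is the equation in degree [s] for
     the sequence without its lead. *)
  have := x0 b s.+1; rewrite convS; have := vb b bp => vbN.
  by rewrite ab ?mulr0 ?addr0 //; [apply; lia | lia].
(* The value at [N] that the equation of block [p] in degree [N] forces. No other equation involves
   it, since the other leads vanish. *)
pose y := - (\sum_(r < N) x r * a p (N - r)%N) / a p 0%N.
pose x' r := if r == N then y else x r.
exists x'; first by exists r; rewrite /x' ?ltnS ?(ltnW ltr) // ltn_eqF.
move=> b s; have [-> | bp] := eqVneq b p => les lts.
  have [->|sN] := eqVneq s N.
    rewrite /conv big_ord_recr /= subnn {2}/x' eqxx /y divfK //.
    rewrite (eq_bigr (fun r : 'I_N => x r * a p (N - r)%N)) ?subrr // => i _.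
    by rewrite /x' ltn_eqF.
  have := x0 p s; rewrite eqxx => <-; [|lia|lia].
  by apply: eq_conv => // e lee; rewrite /x' ltn_eqF //; lia.
case: s les lts => [|s] les lts; first by have := vb b bp; lia.
rewrite convS ab ?mulr0 ?addr0 //; last by lia.
have := x0 b s; rewrite (negPf bp) => <-; [|lia|lia].
by apply: eq_conv => // e lee; rewrite /x' ltn_eqF //; lia.
Qed.

End Singular.

Lemma gammaS q d : (0 < d)%N -> gamma q d.+1 = gamma q d * (1 - 1 / q%:R ^+ d).
Proof. by move=> d_gt0; rewrite /gamma big_nat_recr. Qed.

(** * Nonsingularity probability for fixed attics *)

Section Core.
Variables (F : finFieldType) (B : finType) (T : nat).
Implicit Types (v : B -> nat) (X : pred B) (l : B -> F) (h : B -> nat -> F).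
Implicit Types (w : {ffun B * 'I_T.+1 -> F}).

(* The diagonals of block [b], indexed by [e = m + c - r]: the lead [u_0] sits at
   [e = 0], the independent uniform entries [u_1, ..., u_m] at [1 <= e <= m] with
   [m = N - v b], and the attic, whose values [h] are fixed, at [e > m]. *)
Definition diag N v X l h w b e : F :=
  if e == 0%N then (if X b then w (b, ord0) else l b)
  else if (e <= N - v b)%N then w (b, inord e) else h b e.

(** The bound [T] does not change with [N], so every step of the recursion averages over the same
    space; coordinates that [diag] does not read average out. *)
Definition nsprob N v X l h : rat :=
  mean (fun w => (~~ singular N v (diag N v X l h w))%:R).

Lemma card_gt0F : (0 < #|F|)%N.
Proof. exact: ltnW (card_finNzRing_gt1 F). Qed.

Lemma ffun_card_gt0 (K : finType) : (0 < #|{: {ffun K -> F}}|)%N.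
Proof. by rewrite card_ffun expn_gt0 card_gt0F. Qed.

Lemma mean_vanish (S : {set B}) :
  mean (fun t : {ffun B -> F} => ([forall b in S, t b == 0])%:R)
  = 1 / #|F|%:R ^+ #|S|.
Proof.
have q0 : #|F|%:R != 0 :> rat by rewrite pnatr_eq0 -lt0n card_gt0F.
rewrite /mean -natr_sum -big_mkcond sum1_card card_ffun.
have -> : #|[pred t : {ffun B -> F} | [forall b in S, t b == 0]]|
    = (#|F| ^ #|~: S|)%N.
  rewrite -(card_pffun_on (0 : F) (mem (~: S)) predT); apply: eq_card => t.
  rewrite inE; apply/forall_inP/pffun_onP => [t0 | [t0 _] b bS].
    split=> //; apply/subsetP => b; rewrite !inE; apply: contra => /t0 //.
  have := contra (subsetP t0 b); rewrite !inE bS => /(_ isT).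
  by rewrite negbK.
rewrite -(cardsC S) !natrX exprD; field.
by rewrite !expf_neq0.
Qed.

(** Condition on the random leads. If some block of positive width has a nonzero lead, the
    probability is [g]; if none has, the last row vanishes and it is 0. The second event requires
    the fixed leads to be 0 and each random lead to hit 0. *)
Lemma nsprob_mixed N v X l h (g : rat) : (0 < N <= T.+1)%N ->
  (forall l, [exists b, (0 < v b)%N && (l b != 0)] -> nsprob N v pred0 l h = g) ->
  nsprob N v X l h =
  g * (1 - ([forall b, (0 < v b)%N ==> ~~ X b ==> (l b == 0)])%:R
           / #|F|%:R ^+ #|[set b | (0 < v b)%N && X b]|).
Proof.
move=> /andP[N_gt0 leNT] fixed_lead.
pose iota b : option (B * 'I_T.+1) := if X b then Some (b, ord0) else None.
have iota_inj b b' i : iota b = Some i -> iota b' = Some i -> b = b'.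
  by rewrite /iota; case: (X b) => // -[<-]; case: (X b') => // -[].
pose mixed (t : {ffun B -> F}) b := if X b then t b else l b.
have diag_override w t b e : (e < N)%N ->
    diag N v X l h (override iota w t) b e = diag N v pred0 (mixed t) h w b e.
  move=> ltN; rewrite /diag /mixed; case: eqP => [_ | e0] /=.
    by case: ifP => // Xb; rewrite (override_some iota_inj _ _ (j := b)) // /iota Xb.
  case: ifP => // le_e; rewrite override_none // => b'; rewrite /iota.
  case: ifP => // _ [_ /(congr1 val)]; rewrite /= inordK => [/esym//|].
  exact: leq_trans ltN leNT.
rewrite /nsprob (mean_override iota_inj) ?card_gt0F //.
transitivity (mean (fun w => mean (fun t =>
    (~~ singular N v (diag N v pred0 (mixed t) h w))%:R : rat))).
  apply: eq_mean => w; apply: eq_mean => t.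
  by rewrite (eq_singular _ (diag_override w t)).
rewrite exchange_mean -[X in mean X]/(fun t => nsprob N v pred0 (mixed t) h).
set S := [set b | _ && _]; set C := [forall b, _].
transitivity (mean (fun t : {ffun B -> F} =>
    g * (1 - C%:R * ([forall b in S, t b == 0])%:R))).
  apply: eq_mean => t; rewrite -natrM mulnb.
  have -> : C && [forall b in S, t b == 0] =
      ~~ [exists b, (0 < v b)%N && (mixed t b != 0)].
    apply: esym; apply/existsPn/andP => [t0 | [/forallP C0 /forall_inP t0] b].
      split; apply/forallP => b; have := t0 b; rewrite /mixed ?inE;
        by case: (0 < v b)%N; case: (X b); rewrite /= ?negbK.
    have := t0 b; have := C0 b; rewrite /mixed inE.
    by case: (0 < v b)%N; case: (X b) => //= [_ /(_ isT)|]->.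
  case: (boolP [exists b, _]) => [ex|nex] /=.
    by rewrite fixed_lead // subr0 mulr1.
  rewrite subrr mulr0 /nsprob; apply: etrans (mean_const 0 (ffun_card_gt0 _)).
  apply: eq_mean => w; rewrite singular_lead0 // => b vb; rewrite /diag eqxx /=.
  by move/existsPn/(_ b): nex; rewrite vb /= negbK => /eqP.
rewrite meanMl meanB mean_const ?ffun_card_gt0 // meanMl mean_vanish.
by rewrite mulrA mulr1.
Qed.

(** The value depends on neither [l] nor [h]; the induction on [N] needs this freedom, because one
    reduction step changes widths, leads and attics. *)
Lemma nsprob_fixed N v l h : (0 < N)%N -> (N <= T.+1)%N -> N = (\sum_b v b)%N ->
  [exists b, (0 < v b)%N && (l b != 0)] ->
  nsprob N v pred0 l h = gamma #|F| #|[set b | (0 < v b)%N]|.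
Proof.
elim: N v l h => // N IHN v l h _ leNT sumv exl.
pose lead b := (0 < v b)%N && (l b != 0).
have [p0 lead0] : exists p, lead p by apply/existsP.
case: (arg_maxnP v lead0) => p /andP[vp lp] widest.
have [vN vN'] : (v p <= N.+1)%N /\ forall b, b != p -> (v b <= N)%N.
  split; first by rewrite sumv (bigD1 p) //= leq_addr.
  by move=> b bp; move: sumv; rewrite (bigD1 p) //= (bigD1 b) //=; lia.
(* The multiple of block [p] that cancels the lead of [b]. *)
pose c b := if lead b && (b != p) then l b / l p else 0.
pose l1 b := if lead b && (b != p) then 0 else l b.
pose h1 b e := h b e - c b * h p e.
(* The effect of the column operations on the random entries. It is a shear: block [p] is untouched,
   and every other coordinate is translated by an amount determined by block [p]. *)
pose red w : {ffun B * 'I_T.+1 -> F} :=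
  [ffun i => w i - c i.1 *
     (if (i.2 <= N.+1 - v p)%N then w (p, i.2) else h p i.2)].
have cp : c p = 0 by rewrite /c eqxx andbF.
have c_wide b : c b != 0 -> (v b <= v p)%N.
  by rewrite /c; case: ifP => [/andP[lb _] _|]; [apply: widest | rewrite eqxx].
have red_inj : injective red.
  move=> w w' /ffunP ww'.
  have wp e : w (p, e) = w' (p, e).
    by have := ww' (p, e); rewrite !ffunE /= cp !mul0r !subr0.
  by apply/ffunP => -[b e]; have := ww' (b, e); rewrite !ffunE /= wp => /addIr.
have red_diag w b e : (e < N.+1)%N ->
    diag N.+1 v pred0 l h w b e - c b * diag N.+1 v pred0 l h w p e
    = diag N.+1 v pred0 l1 h1 (red w) b e.
  move=> ltN; rewrite /diag /=; case: eqP => [_|_].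
    rewrite /c /l1; case: ifP => _; last by rewrite mul0r subr0.
    by rewrite divfK // subrr.
  rewrite ffunE /= inordK; last exact: leq_trans ltN leNT.
  rewrite /h1; have [->|cb] := eqVneq (c b) 0; first by rewrite !mul0r !subr0.
  (* Here [p] is at least as wide as [b], so an attic diagonal of [b] is also one of [p], and the
     subtraction involves only [h]. *)
  case: ifP => [//|leb]; rewrite ifN //.
  by have := c_wide _ cb; lia.
have -> : nsprob N.+1 v pred0 l h = nsprob N.+1 v pred0 l1 h1.
  rewrite /nsprob -[RHS](mean_reindex _ red_inj); apply: eq_mean => w /=.
  by rewrite -(eq_singular _ (red_diag w)) (singular_reduce _ _ cp c_wide).
have {exl} l1_0 b : b != p -> (0 < v b)%N -> l1 b = 0.
  move=> bp vb; rewrite /l1 bp andbT; case: ifP => //.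
  by rewrite /lead vb /= => /negbFE/eqP.
have l1p : l1 p != 0 by rewrite /l1 eqxx andbF.
pose v' b := (v b - (b == p))%N.
(* After the expansion, the lead of each block other than [p] is its former [u_1], hence uniform;
   block [p] keeps its fixed lead. *)
pose X' b := b != p.
pose h' b e := if b == p then h1 b e else h1 b e.+1.
(* The cyclic successor makes [shift] a bijection; it does not wrap around at the indices [e < N]
   that are read, because [N < T.+1]. *)
pose shift w : {ffun B * 'I_T.+1 -> F} :=
  [ffun i => if i.1 == p then w i else w (i.1, ordS i.2)].
have shift_inj : injective shift.
  move=> w w' /ffunP ww'; apply/ffunP => -[b e].
  have [bp|bp] := eqVneq b p; first by have := ww' (b, e); rewrite !ffunE /= bp eqxx.
  by have := ww' (b, ord_pred e); rewrite !ffunE /= (negPf bp) ord_predK.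
have shift_diag w b e : (e < N)%N ->
    (if b == p then diag N.+1 v pred0 l1 h1 w b e
     else diag N.+1 v pred0 l1 h1 w b e.+1)
    = diag N v' X' l1 h' (shift w) b e.
  move=> ltN; rewrite /diag /X' /v' /h' !ffunE /=.
  have [->|bp] := eqVneq b p => /=.
    by have -> : (N.+1 - v p = N - (v p - 1))%N by lia.
  have vb := vN' b bp; rewrite subn0 (subSn vb) ltnS /=.
  have ordSe : ordS (inord e : 'I_T.+1) = inord e.+1.
    by apply: val_inj; rewrite /= !inordK ?modn_small //; lia.
  case: eqP => [e0|_]; last by rewrite ordSe.
  rewrite e0 leq0n -e0 -ordSe; congr (w (b, ordS _)).
  by apply: val_inj; rewrite /= inordK // e0.
have -> : nsprob N.+1 v pred0 l1 h1 = nsprob N v' X' l1 h'.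
  rewrite /nsprob -[RHS](mean_reindex _ shift_inj); apply: eq_mean => w /=.
  by rewrite -(eq_singular _ (shift_diag w)) (singular_expand vp).
have sumv' : N = (\sum_b v' b)%N.
  rewrite (bigD1 p) //= /v' eqxx (eq_bigr v) => [|b bp].
    by have := sumv; rewrite (bigD1 p) //=; lia.
  by rewrite (negPf bp) subn0.
have [N0|N_gt0] := posnP N.
  (* The remaining matrix is empty, hence nonsingular, and [p] was the only block of positive
     width. *)
  rewrite /nsprob; under eq_mean => w.
    have -> : singular N v' (diag N v' X' l1 h' w) = false.
      by apply/singularP; rewrite N0 => -[x [r]].
    over.
  rewrite mean_const ?ffun_card_gt0 //.
  have -> : [set b | (0 < v b)%N] = [set p].
    apply/setP => b; rewrite !inE; have [->|bp] := eqVneq b p; first exact: vp.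
    by have := vN' b bp; rewrite N0; lia.
  by rewrite cards1 /gamma big_nil.
rewrite (@nsprob_mixed N v' X' l1 h' (gamma #|F| #|[set b | (0 < v' b)%N]|)).
(* If [p] has width 1 it disappears and only random leads remain, which yields the last factor of
   [gamma]. *)
- have [vp1|vp1] := leqP (v p) 1.
    have act' : [set b | (0 < v b)%N] = p |: [set b | (0 < v' b)%N].
      apply/setP => b; rewrite !inE /v'; have [->|bp] := eqVneq b p.
        by rewrite vp.
      by rewrite subn0.
    have pN : p \notin [set b | (0 < v' b)%N] by rewrite inE /v' eqxx; lia.
    have act_gt0 : (0 < #|[set b | (0 < v' b)%N]|)%N.
      rewrite card_gt0; apply: contraTneq N_gt0 => act0.
      rewrite sumv' big1 // => b _; apply/eqP; rewrite -leqn0 leqNgt.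
      by have /setP/(_ b) := act0; rewrite !inE => ->.
    rewrite act' cardsU1 pN add1n gammaS //.
    have act_neq_p b : (0 < v' b)%N -> b != p.
      by move=> vb; apply: contraNneq pN => <-; rewrite inE.
    have -> : [forall b, (0 < v' b)%N ==> ~~ X' b ==> (l1 b == 0)].
      by apply/forallP => b; apply/implyP => /act_neq_p bp; rewrite /X' bp.
    have -> // : [set b | (0 < v' b)%N && X' b] = [set b | (0 < v' b)%N].
    by apply/setP => b; rewrite !inE; apply: andb_idr; apply: act_neq_p.
  (* If [p] survives, its nonzero fixed lead excludes that all leads vanish, so the correction
     factor is 1. *)
  have -> : [set b | (0 < v' b)%N] = [set b | (0 < v b)%N].
    apply/setP => b; rewrite !inE /v'; have [->|bp] := eqVneq b p; first by lia.
    by rewrite subn0.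
  have /negbTE -> : ~~ [forall b, (0 < v' b)%N ==> ~~ X' b ==> (l1 b == 0)].
    apply/forallPn; exists p; rewrite /X' eqxx (negPf l1p) /= /v' eqxx.
    by rewrite implybF negbK; lia.
  by rewrite mul0r subr0 mulr1.
- by rewrite N_gt0 ltnW.
- by move=> l' exl'; apply: IHN => //; apply: ltnW.
Qed.

End Core.

(** * Indeterminates and their evaluation *)

Section Indeterminates.
Variables (F : finFieldType) (n : nat).
Implicit Types p : {mpoly F[n]}.

Lemma indet_not_const p : is_indet p -> ~~ is_const p.
Proof.
move=> /existsP[x /eqP ->]; apply/existsP => -[a /eqP Xa].
have /(congr1 (meval (fun=> 0))) := Xa; rewrite mevalXU mevalC => a0.
have /(congr1 (meval (fun=> 1))) := Xa; rewrite mevalXU mevalC -a0.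
by apply/eqP; rewrite oner_eq0.
Qed.

Lemma appears_in_indet (x : 'I_n) : appears_in x ('X_x : {mpoly F[n]}).
Proof. by rewrite /appears_in msuppX /= mnm1E eqxx. Qed.

Lemma eq_meval_appears p (s t : 'I_n -> F) :
  (forall x, appears_in x p -> s x = t x) -> p.@[s] = p.@[t].
Proof.
move=> st; rewrite !mevalE; apply: eq_big_seq => mon mon_p; congr (_ * _).
apply: eq_bigr => x _; have [->|mx] := eqVneq (mon x) 0%N; first by rewrite !expr0.
by rewrite st //; apply/hasP; exists mon.
Qed.

Lemma meval_det N (M : 'M[{mpoly F[n]}]_N) (t : 'I_n -> F) :
  (\det M).@[t] = \det (map_mx (meval t) M).
Proof. by rewrite det_map_mx. Qed.

(** The determinant depends only on indeterminates appearing in [M], so drawing values for the whole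
    pool does not change the probability. *)
Lemma SiPrE N (M : 'M[{mpoly F[n]}]_N) :
  SiPr M = mean (fun t : {ffun 'I_n -> F} => ((\det M).@[t] == 0)%:R).
Proof.
pose iota (j : {x | x \in indets M}) := Some (val j).
have iota_inj j j' i : iota j = Some i -> iota j' = Some i -> j = j'.
  by move=> [<-] [/val_inj].
rewrite (mean_override iota_inj) ?card_gt0F //.
rewrite -[LHS](@mean_const {ffun 'I_n -> F}) ?ffun_card_gt0 //.
apply: eq_mean => t; rewrite /SiPr /mean -natr_sum -sum1_card big_mkcond /=.
congr (_%:R / _); apply: eq_bigr => w _; rewrite inE.
have -> // : (\det M).@[subst_of w] = (\det M).@[override iota t w].
rewrite !meval_det; congr (\det _); apply/matrixP => r c; rewrite !mxE.
apply: eq_meval_appears => x xrc.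
have xM : x \in indets M.
  by rewrite inE; apply/existsP; exists r; apply/existsP; exists c.
by rewrite /subst_of insubT /= (override_some iota_inj t w (j := Sub x xM)).
Qed.

End Indeterminates.

(** * The diagonals of a slant matrix as a sequence *)

Section SlantSequence.
Variables (F : finFieldType) (n u v : nat) (A : 'M[{mpoly F[n]}]_(u, v)).
Local Notation m := (u - v)%N.

(* The entry on the diagonal [r - c = m - e] lying in the first row or column:
   both truncated subtractions are exact for it. *)
Definition slant_seq e : {mpoly F[n]} :=
  if (insub (m - e)%N : option 'I_u, insub (e - m)%N : option 'I_v)
    is (Some r, Some c) then A r c else 0.

Hypothesis slantA : slant A.

Lemma slant_seq_entry e : (e < u)%N ->
  exists (r : 'I_u) (c : 'I_v),
    [/\ (r = m - e :> nat)%N, (c = e - m :> nat)%N & slant_seq e = A r c].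
Proof.
case: slantA => /andP[v1 vu] _ ltu.
have lr : (m - e < u)%N by lia.
have lc : (e - m < v)%N by lia.
by exists (Ordinal lr), (Ordinal lc); rewrite /slant_seq !insubT.
Qed.

Lemma slantE r c :
  A r c = if (r <= c + m)%N then slant_seq (c + m - r) else 0.
Proof.
case: slantA => /andP[v1 vu] [toeplitz [basement _]].
case: leqP => [le_rc | /basement //].
have lu : (c + m - r < u)%N by move: (ltn_ord c); lia.
have [r' [c' [r'E c'E ->]]] := slant_seq_entry lu.
by apply: toeplitz; lia.
Qed.

Lemma slant_seq_indet_or_const e : (e < u)%N ->
  is_indet (slant_seq e) || is_const (slant_seq e).
Proof.
move=> ltu; have [r [c [rE cE ->]]] := slant_seq_entry ltu.
case: slantA => /andP[v1 vu] [_ [_ [w [wE [w_indet [_ [w0 [attic _]]]]]]]].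
have [le_em | lt_me] := leqP e m; last by apply/orP; apply: attic; lia.
have lem : (e < m.+1)%N by [].
rewrite (wE r c (Ordinal lem)) /=; last by lia.
have [e0|e_gt0] := posnP e; last by rewrite w_indet.
have -> : Ordinal lem = ord0 by apply: val_inj.
by apply/orP; case: w0 => [[]|]; auto.
Qed.

Lemma slant_seq_indet e : (0 < e <= m)%N -> is_indet (slant_seq e).
Proof.
case: slantA => /andP[v1 vu] [_ [_ [w [wE [w_indet _]]]]] /andP[e_gt0 le_em].
have [r [c [rE cE ->]]] := @slant_seq_entry e ltac:(lia).
have lem : (e < m.+1)%N by [].
by rewrite (wE r c (Ordinal lem)) /=; [apply: w_indet | lia].
Qed.

(** This makes the indeterminates among the [u_e] of a block independent of each other and of its
    attic. The cases follow the distinctness clauses of [slant], with [u_0] treated apart since it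
    may be constant. *)
Lemma slant_seq_inj e e' : (e <= m)%N -> (e' < u)%N ->
  is_indet (slant_seq e) -> slant_seq e = slant_seq e' -> e = e'.
Proof.
case: slantA => /andP[v1 vu] [_ [_ [w [wE [_ [w_inj [w0 [_ attic]]]]]]]].
move=> le_em lt_e'u.
have seqE i (lim : (i < m.+1)%N) : slant_seq i = w (Ordinal lim).
  have [r [c [rE cE ->]]] := @slant_seq_entry i ltac:(lia).
  by apply: wE => /=; lia.
have lem : (e < m.+1)%N by [].
have [le_e'm | lt_me'] := leqP e' m; last first.
  have [r [c [rE cE ->]]] := slant_seq_entry lt_e'u.
  rewrite (seqE _ lem) => iw wA; case: (attic r c (Ordinal lem)) => //; first by lia.
  by rewrite -wA.
have le'm : (e' < m.+1)%N by [].
rewrite (seqE _ lem) (seqE _ le'm) => iw ww'.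
have w0_lead i (lim : (i < m.+1)%N) :
    w ord0 = w (Ordinal lim) -> is_indet (w ord0) -> i = 0%N.
  move=> w0i iw0; case: w0 => [[_ w0]|cw0]; last first.
    by have := indet_not_const iw0; rewrite cw0.
  by have [//|i_gt0] := posnP i; case: (w0 (Ordinal lim)).
have [e0|e_gt0] := posnP e.
  move: iw ww'; have -> : Ordinal lem = ord0 by apply: val_inj.
  by move=> iw /w0_lead ->.
have [e'0|e'_gt0] := posnP e'.
  move: ww'; have -> : Ordinal le'm = ord0 by apply: val_inj.
  by move=> ww0; rewrite e'0; apply: (w0_lead _ lem); rewrite -?ww0.
by have /(congr1 val) := w_inj (Ordinal lem) (Ordinal le'm) e_gt0 e'_gt0 ww'.
Qed.

Lemma u0_satisfiesE P : u0_satisfies P A = P (slant_seq 0).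
Proof.
case: slantA => /andP[v1 vu] _; apply/existsP/idP => [[r /existsP[c]] | P0].
  by case/andP=> /eqP rE; rewrite slantE rE leqnn subnn.
have [r [c [rE cE EA]]] := @slant_seq_entry 0 ltac:(lia).
by exists r; apply/existsP; exists c; rewrite -EA P0 rE cE sub0n subn0 eqxx.
Qed.

Lemma slant_seq_appears e x : (e < u)%N -> slant_seq e = 'X_x -> x \in indets A.
Proof.
move=> ltu ex; have [r [c [_ _ EA]]] := slant_seq_entry ltu.
rewrite inE; apply/existsP; exists r; apply/existsP; exists c.
by rewrite -EA ex appears_in_indet.
Qed.

End SlantSequence.

(** * From multislant matrices to sequences, and the final count *)

Lemma singular_mxrow (F : finFieldType) n k (v : 'I_k -> nat)
  (A : forall b, 'M[{mpoly F[n]}]_(\sum_b v b, v b)) (t : 'I_n -> F) :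
  (forall b, slant (A b)) ->
  ((\det (\mxrow_b A b)).@[t] == 0)
  = singular (\sum_b v b) v (fun b e => (slant_seq (A b) e).@[t]).
Proof.
move=> slantA; set N := (\sum_b v b)%N.
(* Column [c] of block [b] carries the coefficient of degree [c + (N - v b)]; the zero basement cuts
   the sum off at that degree. *)
have mulE (x : 'rV[F]_N) (y : nat -> F) b (c : 'I_(v b)) :
    (forall r : 'I_N, x 0 r = y r) ->
    (x *m map_mx (meval t) (A b)) 0 c
    = conv y (fun e => (slant_seq (A b) e).@[t]) (c + (N - v b)).
  move=> xy; have [/andP[_ vN] _] := slantA b.
  rewrite /conv (big_ord_widen N
    (fun r => y r * (slant_seq (A b) (c + (N - v b) - r)).@[t])); last first.
    by move: (ltn_ord c); rewrite /N in vN *; lia.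
  rewrite !mxE [RHS]big_mkcond; apply: eq_bigr => r _.
  rewrite !mxE xy slantE // ltnS; case: ifP => // _.
  by rewrite meval0 mulr0.
have mxrow_map : map_mx (meval t) (\mxrow_b A b) = \mxrow_b map_mx (meval t) (A b).
  by apply/matrixP => r c; rewrite !mxE.
rewrite meval_det mxrow_map; apply/det0P/singularP => [[x nzx xA] | [y [r ltr yr] y0]].
  have [r xr] : exists r, x 0 r != 0.
    by move/rV0Pn: nzx.
  pose y := zext [ffun r => x 0 r].
  have xy r' : x 0 r' = y r' by rewrite /y /zext valK /= ffunE.
  exists y; first by exists r; rewrite -?xy.
  move=> b s les lts; move: xA; rewrite mul_mxrow -mxrow0 => /eq_mxrowP/(_ b).
  have lc : (s - (N - v b) < v b)%N by lia.
  move/matrixP/(_ 0 (Ordinal lc)); rewrite (mulE _ y) // mxE /=.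
  by rewrite subnK.
exists (\row_r y r).
  by apply/rV0Pn; exists (Ordinal ltr); rewrite mxE.
rewrite mul_mxrow -mxrow0; apply/eq_mxrowP => b; apply/rowP => c.
rewrite (mulE _ y) => [|r']; last by rewrite mxE.
have [/andP[_ vN] _] := slantA b.
rewrite mxE y0 ?leq_addl // -/N.
by move: (ltn_ord c); rewrite -/N in vN; lia.
Qed.

Theorem theorem3p12 (F : finFieldType) (q : nat) (hq : #|F| = q)
  (n k : nat) (v : 'I_k -> nat)
  (A : forall b : 'I_k, 'M[{mpoly F[n]}]_(\sum_(b' < k) v b', v b))
  (hA : multislant A)
  (hpos : (0 < \sum_(b < k) v b)%N)
  (i j l : nat) (hsig : signature A = (i, j, l)) :
  SiPr (\mxrow_(b < k) A b)
  = 1 - gamma q k * (1 - 0 ^+ l / q%:R ^+ i).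
Proof.
case: hA => slantA disjA; case: hsig => iE _ lE.
set N := (\sum_b v b)%N in hpos.
pose P b := slant_seq (A b).
have v_gt0 b : (0 < v b)%N by have [/andP[]] := slantA b.
pose X b := is_indet (P b 0%N).
(* Only indeterminates among the [u_e] are matched. By [P_inj] below, such an indeterminate sits on
   a single diagonal of a single block, so resampling it leaves the attics alone. *)
pose iota (be : 'I_k * 'I_N.+1) : option 'I_n :=
  if (be.2 <= N - v be.1)%N then [pick x | P be.1 be.2 == 'X_x] else None.
have iotaP b (e : 'I_N.+1) x :
    iota (b, e) = Some x -> (e <= N - v b)%N /\ P b e = 'X_x.
  by rewrite /iota /=; case: ifP => // le_e; case: pickP => //= y /eqP Py [<-].
have P_inj b b' e e' x : (e <= N - v b)%N -> (e' < N)%N ->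
    P b e = 'X_x -> P b' e' = 'X_x -> (b, e) = (b', e').
  move=> le_e lt_e' Pbe Pbe'.
  have lt_e : (e < N)%N by have := v_gt0 b; lia.
  have bb' : b = b'.
    apply/eqP; apply: contraT => /disjA /disjoint_setI0 /setP /(_ x).
    rewrite in_setI in_set0 (slant_seq_appears (slantA b) lt_e Pbe).
    by rewrite (slant_seq_appears (slantA b') lt_e' Pbe').
  rewrite -bb' in Pbe' *; congr (_, _).
  apply: (slant_seq_inj (slantA b) le_e lt_e'); last by rewrite -/(P b) Pbe Pbe'.
  by rewrite -/(P b) Pbe; apply/existsP; exists x.
have iota_inj be be' x : iota be = Some x -> iota be' = Some x -> be = be'.
  case: be be' => [b e] [b' e'] /iotaP[le_e Pbe] /iotaP[le_e' Pbe'].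
  have lt_e' : (e' < N)%N by have := v_gt0 b'; lia.
  by have [-> /val_inj ->] := P_inj _ _ _ _ _ le_e lt_e' Pbe Pbe'.
have iota_indet b (e : 'I_N.+1) : (e <= N - v b)%N -> is_indet (P b e) ->
    exists2 x, P b e = 'X_x & iota (b, e) = Some x.
  move=> le_e /existsP[y Py]; rewrite /iota /= le_e; case: pickP => [x /eqP Px|/(_ y)].
    by exists x.
  by rewrite Py.
(* The evaluation point is arbitrary: [lead b] is read only when [u_0] is constant. *)
pose lead b := (P b 0%N).@[fun=> 0].
pose attic (t : {ffun 'I_n -> F}) b e := (P b e).@[t].
have P_diag t w b e : (e < N)%N ->
    (P b e).@[override iota t w] = diag N v X lead (attic t) w b e.
  move=> lt_e; rewrite /diag.
  have inordE : (inord e : 'I_N.+1) = e :> nat by rewrite inordK // ltnW.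
  have free (e' : 'I_N.+1) : (e' <= N - v b)%N -> is_indet (P b e') ->
      (P b e').@[override iota t w] = w (b, e').
    move=> le_e' /(iota_indet _ _ le_e')[x Px ix].
    by rewrite Px mevalXU (override_some iota_inj _ _ ix).
  have const e' s s' : is_const (P b e') -> (P b e').@[s] = (P b e').@[s'].
    by move=> /existsP[a /eqP ->]; rewrite !mevalC.
  have ioc := slant_seq_indet_or_const (slantA b) lt_e.
  case: eqP => [e0|/eqP e_neq0].
    rewrite e0 in ioc *; case: ifP => Xb; first exact: (free ord0).
    by move: ioc; rewrite -/(P b) -/(X b) Xb /=; apply: const.
  case: ifP => le_e.
    rewrite -[in LHS]inordE; apply: free; rewrite inordE //.
    by apply: (slant_seq_indet (slantA b)); rewrite lt0n e_neq0.
  case/orP: ioc => [/existsP[x /eqP Px]|]; last exact: const.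
  rewrite /attic {1}/P Px /P Px !mevalXU override_none // => -[b' e'] /iotaP[le_e' Pe'].
  by have [bb' ee'] := P_inj _ _ _ _ _ le_e' lt_e Pe' Px;
    rewrite -ee' -bb' le_e' in le_e.
rewrite SiPrE.
transitivity (mean (fun t : {ffun 'I_n -> F} =>
    1 - (~~ singular N v (fun b e => (P b e).@[t]))%:R)).
  apply: eq_mean => t; rewrite singular_mxrow // -/N.
  by case: (singular _ _ _); rewrite ?subr0 ?subrr.
rewrite meanB mean_const ?ffun_card_gt0 //; congr (1 - _).
rewrite (mean_override iota_inj) ?card_gt0F //.
(* For every fixed [t], hence for all attic values, the conditional probability is the same. *)
apply: etrans (mean_const _ (ffun_card_gt0 F 'I_n)); apply: eq_mean => t.
transitivity (nsprob N N v X lead (attic t)).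
  by apply: eq_mean => w; rewrite (eq_singular _ (P_diag t w)).
rewrite (@nsprob_mixed _ _ N N v X lead (attic t) (gamma q k)); first last.
- move=> l' ex; rewrite (nsprob_fixed _ hpos (leqnSn N) (erefl N) ex) hq.
  congr (gamma _ _).
  rewrite -[RHS](card_ord k) -cardsT; apply: eq_card => b; rewrite !inE.
  exact: v_gt0.
- by rewrite hpos leqnSn.
have typeE Q b : u0_satisfies Q (A b) = Q (P b 0%N) by apply: u0_satisfiesE.
rewrite hq; congr (_ * (1 - _ / _ ^+ _)).
  (* [0 ^+ l] is 1 exactly when no block has type 1, that is, when every constant [u_0] is 0. *)
  rewrite expr0n -lE; congr (_%:R); congr nat_of_bool.
  rewrite cards_eq0; apply/forallP/eqP => [lead0 | type1_0 b].
    apply/setP => b; rewrite !inE /type1 typeE; apply/existsP => -[a].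
    case/andP => a0 /eqP Pa; have := lead0 b.
    rewrite v_gt0 /= /lead Pa mevalC (negPf a0) implybF negbK /X => /indet_not_const.
    by move/existsP; apply; exists a; rewrite Pa.
  apply/implyP => _; apply/implyP => nX; move/setP/(_ b): type1_0.
  rewrite !inE /type1 typeE => /existsPn ncst.
  have := slant_seq_indet_or_const (slantA b) hpos; rewrite -/(P b) -/(X b) (negPf nX).
  case/existsP => a /eqP Pa; rewrite /lead Pa mevalC.
  by have := ncst a; rewrite Pa eqxx andbT negbK.
by rewrite -iE; apply: eq_card => b; rewrite !inE v_gt0 /typeX typeE.
Qed.
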